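(* Let $\mathbb{P}$ and $\mathbb{O}$ be finite quantum spaces and let $\tau$ be a trace (tracial state) on $C(\mathbb{M}_{\mathbb{P},\mathbb{O}})$. Then the $(\mathbb{P},\mathbb{O})$-correlation $T_\tau$ is synchronous.
   Context: A quantum space $\mathbb{X}$ is an object of the category dual to the category of C*-algebras; the corresponding C*-algebra is denoted $C_0(\mathbb{X})$, or $C(\mathbb{X})$ when it is unital; $\mathbb{X}$ is compact if $C(\mathbb{X})$ is unital and finite if $C(\mathbb{X})$ is finite-dimensional. $\mathrm{Mor}(A,B)$ is the set of non-degenerate $*$-homomorphisms $A\to M(B)$ (multiplier algebra). $\otimes$ is the minimal tensor product. For $\mathbb{P}$ finite and $\mathbb{O}$ compact, $(C(\mathbb{M}_{\mathbb{P},\mathbb{O}}),\boldsymbol{\Phi}_{\mathbb{P},\mathbb{O}})$ denotes the (existing, unique up to isomorphism) pair consisting of a unital C*-algebra and a unital $*$-homomorphism $\boldsymbol{\Phi}_{\mathbb{P},\mathbb{O}}\colon C(\mathbb{O})\to C(\mathbb{P})\otimes C(\mathbb{M}_{\mathbb{P},\mathbb{O}})$ with the universal property: for every quantum space $\mathbb{X}$ and every $\Psi\in\mathrm{Mor}(C(\mathbb{O}),C(\mathbb{P})\otimes C_0(\mathbb{X}))$ there is a unique $\Lambda\in\mathrm{Mor}(C(\mathbb{M}_{\mathbb{P},\mathbb{O}}),C_0(\mathbb{X}))$ with $\Psi=(\mathrm{id}\otimes\Lambda)\circ\boldsymbol{\Phi}_{\mathbb{P},\mathbb{O}}$. Fix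 decompositions $C(\mathbb{P})=\bigoplus_{l=1}^{N_{\mathbb{P}}}\mathrm{Mat}_{m_l}(\mathbb{C})$ and $C(\mathbb{O})=\bigoplus_{k=1}^{N_{\mathbb{O}}}\mathrm{Mat}_{n_k}(\mathbb{C})$ with matrix units $f^{l}_{st}$ ($1\le l\le N_{\mathbb{P}}$, $1\le s,t\le m_l$) and $e^{k}_{ij}$ ($1\le k\le N_{\mathbb{O}}$, $1\le i,j\le n_k$). A $(\mathbb{P},\mathbb{O})$-correlation is a unital completely positive map $T\colon C(\mathbb{O})\otimes C(\mathbb{O})\to C(\mathbb{P})\otimes C(\mathbb{P})$. Its coefficients $X^{l,st;\,l',s't'}_{k,ij;\,k',i'j'}\in\mathbb{C}$ are defined by $T(e^k_{ij}\otimes e^{k'}_{i'j'})=\sum_{l,l',s,t,s',t'}X^{l,st;\,l',s't'}_{k,ij;\,k',i'j'}\,f^l_{st}\otimes f^{l'}_{s't'}$. $T$ is called synchronous if $\sum_{k,l,i,j,s,t}\frac{1}{n_km_l}X^{l,st;\,l,st}_{k,ij;\,k,ij}=N_{\mathbb{P}}$. Define $V^{l,st}_{k,ij}\in C(\mathbb{M}_{\mathbb{P},\mathbb{O}})$ by $\boldsymbol{\Phi}_{\mathbb{P},\mathbb{O}}(e^k_{ij})=\sum_{l,s,t}f^l_{st}\otimes V^{l,st}_{k,ij}$. For a tracial state $\tau$ on $C(\mathbb{M}_{\mathbb{P},\mathbb{O}})$, $T_\tau$ is the $(\mathbb{P},\mathbb{O})$-correlation determined by $$T_\tau(e^k_{ij}\otimes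 e^{k'}_{i'j'})=\sum_{s,t,s',t',l,l'}\tau\bigl(V^{l,st}_{k,ij}V^{l',t's'}_{k',j'i'}\bigr)\,f^l_{st}\otimes f^{l'}_{s't'} .$$ (It is the correlation $x\otimes y\mapsto(\mathrm{id}\otimes\mathrm{id}\otimes\sigma_\tau)(\boldsymbol{\Phi}_{\mathbb{P},\mathbb{O}}(x)_{13}\boldsymbol{\Phi}_{\mathbb{P},\mathbb{O}}(y)_{24})$, where $\sigma_\tau$ is a state on $C(\mathbb{M}_{\mathbb{P},\mathbb{O}})\otimes_{\max}C(\mathbb{M}_{\mathbb{P},\mathbb{O}})$ with $\sigma_\tau(V^{l,st}_{k,ij}\otimes V^{l',s't'}_{k',i'j'})=\tau(V^{l,st}_{k,ij}V^{l',t's'}_{k',j'i'})$.) *)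

(* Defs.v *)
From HB Require Import structures.
From mathcomp Require Import all_boot all_order all_algebra.
From mathcomp Require Import complex.
From mathcomp Require Import all_classical all_reals all_analysis.

Set Implicit Arguments.
Unset Strict Implicit.
Unset Printing Implicit Defensive.

Import Order.TTheory GRing.Theory Num.Theory.
Import numFieldNormedType.Exports.

Local Open Scope ring_scope.
Local Open Scope classical_set_scope.

(* MathComp rings are unital, whereas the C*-algebra C_0(X) of a quantum space *)
(* need not be; hence a separate hierarchy of *-algebras over modules.         *)

HB.mixin Record isStarAlgebra (C : numClosedFieldType) A
    of GRing.Lmodule C A := {
  smul : A -> A -> A;
  star : A -> A;
  smulA : associative smul;
  smulDl : left_distributive smul +%R;
  smulDr : right_distributive smul +%R;
  smulZl : forall (c : C) x y, smul (c *: x) y = c *: smul x y;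
  smulZr : forall (c : C) x y, smul x (c *: y) = c *: smul x y;
  starK : involutive star;
  starD : {morph star : x y / x + y};
  starZ : forall (c : C) x, star (c *: x) = c^* *: star x;
  starM : forall x y, star (smul x y) = smul (star y) (star x)
}.

#[short(type="starAlgType")]
HB.structure Definition StarAlgebra (C : numClosedFieldType) :=
  {A of isStarAlgebra C A & GRing.Lmodule C A}.

HB.mixin Record StarAlgebra_isUnital (C : numClosedFieldType) A
    of StarAlgebra C A := {
  sone : A;
  smul1l : left_id sone (@smul C A);
  smul1r : right_id sone (@smul C A)
}.

#[short(type="unitalStarAlgType")]
HB.structure Definition UnitalStarAlgebra (C : numClosedFieldType) :=
  {A of StarAlgebra_isUnital C A & StarAlgebra C A}.

HB.mixin Record StarAlgebra_isCStar (R : realType) A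
    of StarAlgebra R[i] A & CompleteNormedModule R[i] A := {
  normr_smul : forall x y : A, `|smul x y| <= `|x| * `|y|;
  normr_cstar : forall x : A, `|smul (star x) x| = `|x| ^+ 2
}.

#[short(type="cstarAlgType")]
HB.structure Definition CStarAlgebra (R : realType) :=
  {A of StarAlgebra_isCStar R A & StarAlgebra R[i] A
      & CompleteNormedModule R[i] A}.

#[short(type="unitalCStarAlgType")]
HB.structure Definition UnitalCStarAlgebra (R : realType) :=
  {A of CStarAlgebra R A & StarAlgebra_isUnital R[i] A}.

Section StarAlgebraTheory.
Variables (C : numClosedFieldType) (A : starAlgType C).
Implicit Types x y : A.

Lemma smul0l x : smul 0 x = 0.
Proof. by rewrite -[X in smul X _](scale0r 0) smulZl scale0r. Qed.

Lemma smul0r x : smul x 0 = 0.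
Proof. by rewrite -[X in smul _ X](scale0r 0) smulZr scale0r. Qed.

Lemma star0 : star (0 : A) = 0.
Proof. by rewrite -[X in star X](scale0r 0) starZ conjC0 scale0r. Qed.

Lemma smul_suml (I : finType) (F : I -> A) y :
  smul (\sum_i F i) y = \sum_i smul (F i) y.
Proof.
apply: (big_morph (fun x => smul x y)); last exact: smul0l.
by move=> a b; rewrite smulDl.
Qed.

Lemma smul_sumr (I : finType) (F : I -> A) x :
  smul x (\sum_i F i) = \sum_i smul x (F i).
Proof.
apply: (big_morph (smul x)); last exact: smul0r.
by move=> a b; rewrite smulDr.
Qed.

Lemma star_sum (I : finType) (F : I -> A) :
  star (\sum_i F i) = \sum_i star (F i).
Proof.
by apply: (big_morph (@star C A)); [exact: starD | exact: star0].
Qed.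

End StarAlgebraTheory.

Section Morphisms.
Variable C : numClosedFieldType.

Definition star_hom (A B : starAlgType C) (f : A -> B) : Prop :=
  [/\ linear f, {morph f : x y / smul x y} & {morph f : x / star x}].

Definition unital_star_hom (A B : unitalStarAlgType C) (f : A -> B) : Prop :=
  star_hom f /\ f (sone : A) = sone.

Definition star_iso (A B : starAlgType C) (f : A -> B) : Prop :=
  star_hom f /\ bijective f.

Definition positive (A : starAlgType C) (x : A) : Prop :=
  exists y : A, x = smul (star y) y.

(* On a unital C*-algebra, a positive functional has norm [tau 1], so states  *)
(* are the positive functionals with [tau 1 = 1].                             *)
Definition tracial_state (A : unitalStarAlgType C) (tau : A -> C) : Prop :=
  [/\ scalar tau,
      forall x, positive x -> 0 <= tau x,
      tau sone = 1
    & forall x y, tau (smul x y) = tau (smul y x)].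

End Morphisms.

Section ComplexNumbers.
Variable C : numClosedFieldType.

Let mulZl (c : C) (x y : C^o) : (c *: x) * y = c *: (x * y).
Proof. exact: esym (mulrA _ _ _). Qed.
Let mulZr (c : C) (x y : C^o) : x * (c *: y) = c *: (x * y).
Proof. exact: mulrCA. Qed.
Let conjZ (c : C) (x : C^o) : (c *: x : C)^* = c^* *: (x : C)^* :> C^o.
Proof. exact: rmorphM. Qed.
Let conjM (x y : C^o) : (x * y : C)^* = (y : C)^* * (x : C)^* :> C^o.
Proof. by rewrite -rmorphM mulrC. Qed.

HB.instance Definition _ := isStarAlgebra.Build C C^o
  (@mulrA C^o) (@mulrDl C^o) (@mulrDr C^o) mulZl mulZr
  (@conjCK C) (rmorphD (@Num.conj C)) conjZ conjM.

HB.instance Definition _ := StarAlgebra_isUnital.Build C C^o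
  (@mul1r C^o) (@mulr1 C^o).

End ComplexNumbers.

Section Multipliers.
Variables (C : numClosedFieldType) (A : starAlgType C).

(* Double centralizers.  On a C*-algebra the identity [centralize] already    *)
(* forces both maps to be bounded, [lact (x y) = (lact x) y] and              *)
(* [ract (x y) = x (ract y)].                                                 *)
Record multiplier := Multiplier {
  lact : A -> A;
  ract : A -> A;
  lact_linear : linear lact;
  ract_linear : linear ract;
  centralize : forall x y, smul x (lact y) = smul (ract x) y
}.

Lemma multiplierP (m1 m2 : multiplier) :
  lact m1 =1 lact m2 -> ract m1 =1 ract m2 -> m1 = m2.
Proof.
case: m1 m2 => [l1 r1 a1 b1 c1] [l2 r2 a2 b2 c2] /= /funext El /funext Er.
by subst l2 r2; congr Multiplier; exact: Prop_irrelevance.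
Qed.

HB.instance Definition _ := gen_eqMixin multiplier.
HB.instance Definition _ := gen_choiceMixin multiplier.

Let lactD (m : multiplier) x y : lact m (x + y) = lact m x + lact m y.
Proof. by have := lact_linear m 1 x y; rewrite !scale1r. Qed.
Let ractD (m : multiplier) x y : ract m (x + y) = ract m x + ract m y.
Proof. by have := ract_linear m 1 x y; rewrite !scale1r. Qed.
Let lact0 (m : multiplier) : lact m 0 = 0.
Proof. by apply: (addrI (lact m 0)); rewrite -lactD !addr0. Qed.
Let ract0 (m : multiplier) : ract m 0 = 0.
Proof. by apply: (addrI (ract m 0)); rewrite -ractD !addr0. Qed.
Let lactZ (m : multiplier) c x : lact m (c *: x) = c *: lact m x.
Proof. by have := lact_linear m c x 0; rewrite lact0 !addr0. Qed.
Let ractZ (m : multiplier) c x : ract m (c *: x) = c *: ract m x.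
Proof. by have := ract_linear m c x 0; rewrite ract0 !addr0. Qed.

Program Definition mzero :=
  @Multiplier (fun=> 0) (fun=> 0) _ _ _.
Next Obligation. by move=> c x y /=; rewrite scaler0 addr0. Qed.
Next Obligation. by move=> c x y /=; rewrite scaler0 addr0. Qed.
Next Obligation. by move=> x y /=; rewrite smul0l smul0r. Qed.

Program Definition mone := @Multiplier id id _ _ (fun=> fun=> erefl).
Next Obligation. by []. Qed.
Next Obligation. by []. Qed.

Program Definition mopp (m : multiplier) :=
  @Multiplier (fun x => - lact m x) (fun x => - ract m x) _ _ _.
Next Obligation. by move=> m c x y /=; rewrite lact_linear opprD scalerN. Qed.
Next Obligation. by move=> m c x y /=; rewrite ract_linear opprD scalerN. Qed.
Next Obligation.
move=> m x y /=; rewrite -[- lact m y]scaleN1r -[- ract m x]scaleN1r.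
by rewrite smulZl smulZr centralize.
Qed.

Program Definition madd (m1 m2 : multiplier) :=
  @Multiplier (fun x => lact m1 x + lact m2 x)
              (fun x => ract m1 x + ract m2 x) _ _ _.
Next Obligation. by move=> m1 m2 c x y /=; rewrite !lact_linear scalerDr addrACA. Qed.
Next Obligation. by move=> m1 m2 c x y /=; rewrite !ract_linear scalerDr addrACA. Qed.
Next Obligation. by move=> m1 m2 x y /=; rewrite smulDl smulDr !centralize. Qed.

Program Definition mscale (c : C) (m : multiplier) :=
  @Multiplier (fun x => c *: lact m x) (fun x => c *: ract m x) _ _ _.
Next Obligation.
by move=> e m c x y /=; rewrite lact_linear scalerDr !scalerA mulrC.
Qed.
Next Obligation.
by move=> e m c x y /=; rewrite ract_linear scalerDr !scalerA mulrC.
Qed.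
Next Obligation. by move=> e m x y /=; rewrite smulZl smulZr centralize. Qed.

Program Definition mmul (m1 m2 : multiplier) :=
  @Multiplier (fun x => lact m1 (lact m2 x))
              (fun x => ract m2 (ract m1 x)) _ _ _.
Next Obligation. by move=> m1 m2 c x y /=; rewrite !lact_linear. Qed.
Next Obligation. by move=> m1 m2 c x y /=; rewrite !ract_linear. Qed.
Next Obligation. by move=> m1 m2 x y /=; rewrite !centralize. Qed.

Program Definition mstar (m : multiplier) :=
  @Multiplier (fun x => star (ract m (star x)))
              (fun x => star (lact m (star x))) _ _ _.
Next Obligation.
by move=> m c x y /=; rewrite !(starD, starZ) ract_linear !(starD, starZ) conjCK.
Qed.
Next Obligation.
by move=> m c x y /=; rewrite !(starD, starZ) lact_linear !(starD, starZ) conjCK.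
Qed.
Next Obligation.
by move=> m x y /=; apply: (can_inj (@starK _ A)); rewrite !starM !starK centralize.
Qed.

Let maddA : associative madd.
Proof. by move=> a b c; apply: multiplierP => x /=; rewrite addrA. Qed.
Let maddC : commutative madd.
Proof. by move=> a b; apply: multiplierP => x /=; rewrite addrC. Qed.
Let madd0 : left_id mzero madd.
Proof. by move=> a; apply: multiplierP => x /=; rewrite add0r. Qed.
Let maddN : left_inverse mzero mopp madd.
Proof. by move=> a; apply: multiplierP => x /=; rewrite addNr. Qed.

HB.instance Definition _ :=
  GRing.isZmodule.Build multiplier maddA maddC madd0 maddN.

Let mscaleA c d m : mscale c (mscale d m) = mscale (c * d) m.
Proof. by apply: multiplierP => x /=; rewrite scalerA. Qed.
Let mscale1 : left_id 1 mscale.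
Proof. by move=> m; apply: multiplierP => x /=; rewrite scale1r. Qed.
Let mscaleDr : right_distributive mscale +%R.
Proof. by move=> c a b; apply: multiplierP => x /=; rewrite scalerDr. Qed.
Let mscaleDl m : {morph mscale^~ m : c d / c + d}.
Proof. by move=> c d; apply: multiplierP => x /=; rewrite scalerDl. Qed.

HB.instance Definition _ := GRing.Zmodule_isLmodule.Build C multiplier
  mscaleA mscale1 mscaleDr mscaleDl.

Let mmulA : associative mmul.
Proof. by move=> a b c; apply: multiplierP. Qed.
Let mmulDl : left_distributive mmul +%R.
Proof. by move=> a b c; apply: multiplierP => x //=; rewrite ractD. Qed.
Let mmulDr : right_distributive mmul +%R.
Proof. by move=> a b c; apply: multiplierP => x //=; rewrite lactD. Qed.
Let mmulZl (c : C) (a b : multiplier) : mmul (c *: a) b = c *: mmul a b.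
Proof. by apply: multiplierP => x //=; rewrite ractZ. Qed.
Let mmulZr (c : C) (a b : multiplier) : mmul a (c *: b) = c *: mmul a b.
Proof. by apply: multiplierP => x //=; rewrite lactZ. Qed.
Let mstarK : involutive mstar.
Proof. by move=> a; apply: multiplierP => x /=; rewrite !starK. Qed.
Let mstarD : {morph mstar : a b / a + b}.
Proof. by move=> a b; apply: multiplierP => x /=; rewrite starD. Qed.
Let mstarZ (c : C) (a : multiplier) : mstar (c *: a) = c^* *: mstar a.
Proof. by apply: multiplierP => x /=; rewrite starZ. Qed.
Let mstarM a b : mstar (mmul a b) = mmul (mstar b) (mstar a).
Proof. by apply: multiplierP => x /=; rewrite !starK. Qed.

HB.instance Definition _ := isStarAlgebra.Build C multiplier
  mmulA mmulDl mmulDr mmulZl mmulZr mstarK mstarD mstarZ mstarM.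

Let mmul1l : left_id mone mmul.
Proof. by move=> a; apply: multiplierP. Qed.
Let mmul1r : right_id mone mmul.
Proof. by move=> a; apply: multiplierP. Qed.

HB.instance Definition _ := StarAlgebra_isUnital.Build C multiplier
  mmul1l mmul1r.

End Multipliers.

(* [Mor A B]: *-homomorphisms phi : A -> M(B) such that phi(A)B has dense     *)
(* linear span in B.                                                          *)
Definition Mor (R : realType) (A : starAlgType R[i]) (B : cstarAlgType R)
    (phi : A -> multiplier B) : Prop :=
  star_hom phi /\
  closure [set b : B | exists (n : nat) (x : 'I_n -> A) (y : 'I_n -> B),
                         b = \sum_(i < n) lact (phi (x i)) (y i)] = setT.

(* A finite quantum space P, given by the decomposition                       *)
(* C(P) = \bigoplus_(l < nblocks P) Mat_(bsize P l)(C).                       *)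
Record finQSpace := FinQSpace {
  nblocks : nat;
  bsize : 'I_nblocks -> nat;
  bsize_gt0 : forall l, (0 < bsize l)%N
}.

(* [ix l s t] indexes the matrix unit f^l_(s,t). *)
Definition munit_index (P : finQSpace) : finType :=
  {l : 'I_(nblocks P) & ('I_(bsize l) * 'I_(bsize l))%type}.

Definition ix (P : finQSpace) (l : 'I_(nblocks P)) (s t : 'I_(bsize l)) :
  munit_index P := existT _ l (s, t).

Definition ixT (P : finQSpace) (p : munit_index P) : munit_index P :=
  ix (tagged p).2 (tagged p).1.

Section FdTensor.
Variables (C : numClosedFieldType) (P : finQSpace).

(* The *-algebra C(P) (x) B = \bigoplus_l Mat_(m_l)(B): the family x stands   *)
(* for \sum_p f^p (x) x p.                                                    *)
Definition fdtensor (B : starAlgType C) : Type := {ffun munit_index P -> B}.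

Section StarAlgebraStructure.
Variable B : starAlgType C.
Local Notation T := (fdtensor B).

HB.instance Definition _ := GRing.Lmodule.on T.

Definition fdt_mul (x y : T) : T :=
  [ffun p : munit_index P => \sum_(r < bsize (tag p))
     smul (x (ix (tagged p).1 r)) (y (ix r (tagged p).2))].

Definition fdt_star (x : T) : T :=
  [ffun p : munit_index P => star (x (ixT p))].

Let fmulA : associative fdt_mul.
Proof.
move=> x y z; apply/ffunP => -[l [s t]]; rewrite !ffunE /=.
under eq_bigr do rewrite ffunE /= smul_sumr.
rewrite exchange_big /=; apply: eq_bigr => r _.
by rewrite ffunE /= smul_suml; apply: eq_bigr => q _; rewrite smulA.
Qed.
Let fmulDl : left_distributive fdt_mul +%R.
Proof.
move=> x y z; apply/ffunP => p; rewrite !ffunE -big_split /=.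
by apply: eq_bigr => r _; rewrite ffunE smulDl.
Qed.
Let fmulDr : right_distributive fdt_mul +%R.
Proof.
move=> x y z; apply/ffunP => p; rewrite !ffunE -big_split /=.
by apply: eq_bigr => r _; rewrite ffunE smulDr.
Qed.
Let fmulZl (c : C) (x y : T) : fdt_mul (c *: x) y = c *: fdt_mul x y.
Proof.
apply/ffunP => p; rewrite !ffunE scaler_sumr.
by apply: eq_bigr => r _; rewrite ffunE smulZl.
Qed.
Let fmulZr (c : C) (x y : T) : fdt_mul x (c *: y) = c *: fdt_mul x y.
Proof.
apply/ffunP => p; rewrite !ffunE scaler_sumr.
by apply: eq_bigr => r _; rewrite ffunE smulZr.
Qed.
Let fstarK : involutive fdt_star.
Proof. by move=> x; apply/ffunP => -[l [s t]]; rewrite !ffunE starK. Qed.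
Let fstarD : {morph fdt_star : x y / x + y}.
Proof. by move=> x y; apply/ffunP => p; rewrite !ffunE starD. Qed.
Let fstarZ (c : C) (x : T) : fdt_star (c *: x) = c^* *: fdt_star x.
Proof. by apply/ffunP => p; rewrite !ffunE starZ. Qed.
Let fstarM x y : fdt_star (fdt_mul x y) = fdt_mul (fdt_star y) (fdt_star x).
Proof.
apply/ffunP => -[l [s t]]; rewrite !ffunE star_sum.
by apply: eq_bigr => r _; rewrite starM !ffunE.
Qed.

HB.instance Definition _ := isStarAlgebra.Build C T
  fmulA fmulDl fmulDr fmulZl fmulZr fstarK fstarD fstarZ fstarM.

End StarAlgebraStructure.

Section UnitalStructure.
Variable B : unitalStarAlgType C.
Local Notation T := (fdtensor B).

Definition fdt_one : T :=
  [ffun p : munit_index P => if (tagged p).1 == (tagged p).2 then sone else 0].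

Let fmul1l : left_id fdt_one (@smul C T).
Proof.
move=> x; apply/ffunP => -[l [s t]]; rewrite ffunE /= (bigD1 s) //= ffunE eqxx.
rewrite smul1l big1 ?addr0 // => r /negbTE; rewrite eq_sym ffunE /= => ->.
by rewrite smul0l.
Qed.
Let fmul1r : right_id fdt_one (@smul C T).
Proof.
move=> x; apply/ffunP => -[l [s t]]; rewrite ffunE /= (bigD1 t) //= ffunE eqxx.
rewrite smul1r big1 ?addr0 // => r /negbTE; rewrite ffunE /= => ->.
by rewrite smul0r.
Qed.

HB.instance Definition _ := StarAlgebra_isUnital.Build C T fmul1l fmul1r.

End UnitalStructure.

(* The *-algebra C(P). *)
Definition fdalg : Type := fdtensor C^o.
HB.instance Definition _ := UnitalStarAlgebra.on fdalg.

Definition munit (p : munit_index P) : fdalg :=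
  [ffun q : munit_index P => (q == p)%:R : C^o].

Definition elem_tensor (B : starAlgType C) (x : fdalg) (b : B) : fdtensor B :=
  [ffun p : munit_index P => (x p : C) *: b].

Definition fdt_map (A B : starAlgType C) (f : A -> B) (x : fdtensor A) :
  fdtensor B := [ffun p : munit_index P => f (x p)].

Lemma munitE (p q : munit_index P) : munit p q = (q == p)%:R.
Proof. exact: ffunE. Qed.

Lemma fdtensorZE (B : starAlgType C) (c : C) (x : fdtensor B) p :
  (c *: x) p = c *: x p.
Proof. exact: ffunE. Qed.

Lemma elem_tensorE (B : starAlgType C) (x : fdalg) (b : B) p :
  elem_tensor x b p = (x p : C) *: b.
Proof. exact: ffunE. Qed.

Lemma fdtensorE (B : starAlgType C) (x : fdtensor B) :
  x = \sum_p elem_tensor (munit p) (x p).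
Proof.
apply/ffunP => q; rewrite sum_ffunE (bigD1 q) //= !ffunE eqxx scale1r.
rewrite big1 ?addr0 // => p /negbTE; rewrite !ffunE eq_sym => ->.
by rewrite scale0r.
Qed.

Lemma munit2E (q q' r r' : munit_index P) :
  elem_tensor (munit q) (munit q' : fdalg) r r' =
  (r == q)%:R * (r' == q')%:R :> C.
Proof.
rewrite elem_tensorE fdtensorZE /GRing.scale /=.
by congr (_ * _); exact: munitE.
Qed.

Lemma sum_munit2 (V : lmodType C) (F : munit_index P -> munit_index P -> V)
    q q' :
  \sum_r \sum_r'
    (elem_tensor (munit q) (munit q' : fdalg) r r' : C) *: F r r' = F q q'.
Proof.
have E := munit2E q q'.
rewrite (bigD1 q) //= (bigD1 q') //= E !eqxx mulr1 scale1r.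
rewrite big1 => [|r' /negbTE nr]; last by rewrite E nr mulr0 scale0r.
rewrite addr0 big1 ?addr0 // => r /negbTE nr.
by apply: big1 => r' _; rewrite E nr mul0r scale0r.
Qed.

(* The inclusion C(P) (x) M(B) -> M(C(P) (x) B). *)
Section MultiplierInclusion.
Variables (B : starAlgType C) (u : fdtensor (multiplier B)).

Definition fdt_lact (d : fdtensor B) : fdtensor B :=
  [ffun p : munit_index P => \sum_(r < bsize (tag p))
     lact (u (ix (tagged p).1 r)) (d (ix r (tagged p).2))].

Definition fdt_ract (d : fdtensor B) : fdtensor B :=
  [ffun p : munit_index P => \sum_(r < bsize (tag p))
     ract (u (ix r (tagged p).2)) (d (ix (tagged p).1 r))].

Program Definition fdt_multiplier : multiplier (fdtensor B) :=
  @Multiplier C (fdtensor B) fdt_lact fdt_ract _ _ _.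
Next Obligation.
move=> c x y; apply/ffunP => p; rewrite !ffunE scaler_sumr -big_split /=.
by apply: eq_bigr => r _; rewrite !ffunE lact_linear.
Qed.
Next Obligation.
move=> c x y; apply/ffunP => p; rewrite !ffunE scaler_sumr -big_split /=.
by apply: eq_bigr => r _; rewrite !ffunE ract_linear.
Qed.
Next Obligation.
move=> x y; apply/ffunP => -[l [s t]]; rewrite !ffunE /=.
under eq_bigr do rewrite ffunE /= smul_sumr.
rewrite exchange_big /=; apply: eq_bigr => r _.
by rewrite ffunE /= smul_suml; apply: eq_bigr => q _; rewrite centralize.
Qed.

End MultiplierInclusion.

End FdTensor.

Arguments munit {C P} p.

(* M(D) is identified with M(E) along a *-isomorphism theta : D -> E.         *)
Definition same_multiplier (C : numClosedFieldType) (D E : starAlgType C)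
    (theta : D -> E) (m : multiplier D) (m' : multiplier E) : Prop :=
  (forall d, theta (lact m d) = lact m' (theta d)) /\
  (forall d, theta (ract m d) = ract m' (theta d)).

(* The universal property characterizing (C(M_(P,O)), Phi_(P,O)).             *)
(* Since C(P) is finite-dimensional, the *-algebra [fdtensor P X] carries     *)
(* exactly one C*-norm and is complete for it; the C*-algebra C(P) (x) C_0(X) *)
(* is thus any C*-algebra D with a *-isomorphism theta : D -> fdtensor P X.   *)
(* The last equation reads Psi = (id (x) Lambda) o Phi.                       *)
Definition universal_family (R : realType) (P O : finQSpace)
    (A : unitalCStarAlgType R) (Phi : fdalg R[i] O -> fdtensor P A) : Prop :=
  unital_star_hom Phi /\
  forall (X D : cstarAlgType R) (theta : D -> fdtensor P X), star_iso theta ->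
  forall Psi : fdalg R[i] O -> multiplier D, Mor Psi ->
  exists! Lambda : A -> multiplier X,
    Mor Lambda /\
    forall x, same_multiplier theta (Psi x)
                (fdt_multiplier (fdt_map Lambda (Phi x))).

Section CompletePositivity.
Variable C : numClosedFieldType.

Definition matQSpace (n : nat) : finQSpace :=
  @FinQSpace 1 (fun=> n.+1) (fun=> ltn0Sn n).

(* [fdtensor (matQSpace n) A] is Mat_(n+1)(A). *)
Definition completely_positive (A B : starAlgType C) (T : A -> B) : Prop :=
  forall (n : nat) (x : fdtensor (matQSpace n) A),
    positive x -> positive (fdt_map T x).

Definition unital_cp (A B : unitalStarAlgType C) (T : A -> B) : Prop :=
  [/\ linear T, completely_positive T & T sone = sone].

End CompletePositivity.

Section Correlations.
Variables (R : realType) (P O : finQSpace).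
Local Notation C := R[i].
Local Notation CC Q := (fdtensor Q (fdalg C Q)).

Definition correlation (T : CC O -> CC P) : Prop := unital_cp T.

(* X^(p;p')_(q;q') *)
Definition coefficient (T : CC O -> CC P) (q q' : munit_index O)
    (p p' : munit_index P) : C :=
  T (elem_tensor (munit q) (munit q')) p p'.

Lemma coefficientE (T : CC O -> CC P) q q' :
  T (elem_tensor (munit q) (munit q')) =
  \sum_p \sum_p' coefficient T q q' p p' *: elem_tensor (munit p) (munit p').
Proof.
rewrite [LHS]fdtensorE; apply: eq_bigr => p _.
rewrite /coefficient; move: (T _ p) => y.
apply/ffunP => r; rewrite elem_tensorE sum_ffunE [in LHS](fdtensorE y).
rewrite scaler_sumr; apply: eq_bigr => p' _.
rewrite [RHS]ffunE elem_tensorE scalerA mulrC -scalerA; congr (_ *: _).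
by apply/ffunP => r'; rewrite elem_tensorE [RHS]ffunE; exact: mulrC.
Qed.

Definition synchronous (T : CC O -> CC P) : Prop :=
  \sum_(k < nblocks O) \sum_(l < nblocks P)
    \sum_(i < bsize k) \sum_(j < bsize k) \sum_(s < bsize l) \sum_(t < bsize l)
      ((bsize k * bsize l)%N%:R)^-1 *
        coefficient T (ix i j) (ix i j) (ix s t) (ix s t)
  = (nblocks P)%:R.

Variables (A : unitalCStarAlgType R) (Phi : fdalg C O -> fdtensor P A).

(* V^p_q, so that Phi(e_q) = \sum_p f_p (x) V^p_q. *)
Definition Vcoef (q : munit_index O) (p : munit_index P) : A :=
  Phi (munit q) p.

Definition T_trace (tau : A -> C) (x : CC O) : CC P :=
  \sum_q \sum_q' (x q q' : C) *:
    \sum_p \sum_p' tau (smul (Vcoef q p) (Vcoef (ixT q') (ixT p'))) *: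
      elem_tensor (munit p) (munit p').

Lemma T_traceE tau q q' :
  T_trace tau (elem_tensor (munit q) (munit q')) =
  \sum_p \sum_p' tau (smul (Vcoef q p) (Vcoef (ixT q') (ixT p'))) *:
    elem_tensor (munit p) (munit p').
Proof.
exact: (sum_munit2 (fun r r' => \sum_p \sum_p'
  tau (smul (Vcoef r p) (Vcoef (ixT r') (ixT p'))) *:
    elem_tensor (munit p) (munit p'))).
Qed.

End Correlations.

(* Main.v *)
(* Let Theta : C(O) (x) C(O) -> C(P) (x) C(P) (x) A be Phi (x) Phi^op         *)
(* followed by the multiplication A (x) A^op -> A, so that                    *)
(* T_tau = tau o Theta.  Since tau is a trace, the entries of T_tau(x^* x)    *)
(* form a Gram matrix for the semi-inner product tau(a^* b) on the entries of *)
(* Theta(x); this matrix is positive semidefinite, hence of the form N^* N by *)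
(* the spectral theorem, and T_tau is completely positive.  Synchronicity     *)
(* comes from e_ij e_ji = e_ii, Phi(1) = 1 and tau(1) = 1.                    *)

Require Import Defs.
From mathcomp Require Import all_boot all_order all_algebra.
From mathcomp Require Import complex.
From mathcomp Require Import all_classical all_reals all_analysis.
From mathcomp Require Import spectral sesquilinear ring.

Set Implicit Arguments.
Unset Strict Implicit.
Unset Printing Implicit Defensive.

Import Order.TTheory GRing.Theory Num.Theory.

Local Open Scope ring_scope.

(** By [T_trace_twist], T_tau is tau applied entrywise to the map Theta, whose entries are [twist].
    Theta respects products only up to the order of the factors in A, and traciality repairs this:
    [tau_twist_gram] rewrites tau of an entry of Theta(x^* y) as a sum of tau(a^* b) over entries a
    of Theta(x) and b of Theta(y). So T_tau(y^* y) is blockwise a Gram matrix, which [trace_gram]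
    factors as N^* N; this gives [tau_twist_cp].

    For synchronicity, the relevant coefficients are tau(V^{st}_{ij} V^{ts}_{ji}). Summing over t
    produces the (s,s) entry of Phi(e_ij) Phi(e_ji) = Phi(e_ii) ([tau_twist_munit]), after which the
    weights 1/(n_k m_l) cancel against the remaining sums. *)

Lemma sum_deltal (R : pzSemiRingType) (I : finType) (F : I -> R) i :
  \sum_j (j == i)%:R * F j = F i.
Proof.
rewrite (bigD1 i) //= eqxx mul1r big1 ?addr0 // => j /negbTE ->.
by rewrite mul0r.
Qed.

(** * Positive semidefinite matrices are Gram matrices *)

Section Gram.
Variables (C : numClosedFieldType) (I : finType) (M : I -> I -> C).
Hypothesis M_psd :
  forall xi : I -> C, 0 <= \sum_i \sum_j (xi i)^* * M i j * xi j.

(** This is the quadratic form at the vector c e_i + d e_j; i = j is allowed. *)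
Lemma psd_pair i j (c d : C) :
  0 <= c^* * (M i i * c + M i j * d) + d^* * (M j i * c + M j j * d).
Proof.
have := M_psd (fun k => (k == i)%:R * c + (k == j)%:R * d).
rewrite (_ : \sum_k _ = \sum_k ((k == i)%:R * c^* + (k == j)%:R * d^*) *
    (M k i * c + M k j * d)).
  under eq_bigr do rewrite mulrDl -!mulrA.
  by rewrite big_split /= !sum_deltal.
apply: eq_bigr => k _; rewrite rmorphD !rmorphM /= !conjC_nat.
under eq_bigr do rewrite -mulrA; rewrite -mulr_sumr; congr (_ * _).
under eq_bigr do rewrite mulrDr mulrCA [M _ _ * (_ * d)]mulrCA.
by rewrite big_split /= !sum_deltal.
Qed.

Lemma psd_hermitian i j : M j i = (M i j)^*.
Proof.
have Mreal a : M a a \is Num.real.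
  have := psd_pair a a 1 0.
  by rewrite conjC1 conjC0 !(mul0r, mulr0, addr0, mul1r, mulr1) => /ger0_real.
(* Polarization: test [M] on the vectors e_i + c e_j with c = 1 and c = 'i. *)
have H (c : C) : c^* * c = 1 ->
    (c * M i j + c^* * M j i)^* = c * M i j + c^* * M j i.
  move=> c1; apply/CrealP.
  rewrite (_ : _ + _ = (1^* * (M i i * 1 + M i j * c) +
    c^* * (M j i * 1 + M j j * c)) - (M i i + M j j)).
    by apply: rpredB; [exact/ger0_real/psd_pair | apply: rpredD].
  by rewrite conjC1 (_ : M j j = (c^* * c) * M j j) ?c1 ?mul1r //; ring: c1.
have /(_ _)/esym h1 := H 'i; have /(_ _)/esym h2 := H 1.
move: h1 h2; rewrite conjC1 conjCi mulNr -expr2 sqrCi opprK mulr1.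
move=> /(_ erefl) + /(_ erefl); rewrite !(rmorphD, rmorphM, rmorphN) /=.
rewrite conjCi conjC1 opprK !mul1r => h1 h2.
(* The case c = 'i says that 'i (M i j - M j i) is real; dividing by 'i makes the difference
   anti-selfconjugate, while c = 1 makes the sum selfconjugate. *)
have {}h1 : M i j - M j i = (M j i)^* - (M i j)^*.
  by apply: (mulfI (neq0Ci C)); rewrite !mulrBr -mulNr h1; ring.
apply: (mulfI (_ : 2 != 0 :> C)); first by rewrite pnatr_eq0.
have -> : 2 * M j i = M i j + M j i - (M i j - M j i) by ring.
by rewrite h1 h2; ring.
Qed.

(** Diagonalize the matrix as P^* D P with P unitary. The k-th eigenvalue is the form evaluated at
    the conjugated k-th row of P, hence nonnegative, and N = sqrt(D) P works. *)
Lemma psd_gram :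
  exists N : I -> I -> C, forall i j, M i j = \sum_k (N k i)^* * N k j.
Proof.
pose A : 'M[C]_#|I| := \matrix_(i, j) M (enum_val i) (enum_val j).
have Aherm : A \is hermsymmx.
  apply/is_hermitianmxP; rewrite expr0 scale1r.
  by apply/matrixP => i j; rewrite !mxE psd_hermitian.
set P := spectralmx A; set d := spectral_diag A.
have PU : P \is unitarymx := spectral_unitarymx A.
have AE : A = (P ^t* *m diag_mx d *m P)%sesqui.
  by rewrite -invmx_unitary //; apply/orthomx_spectralP/hermitian_normalmx.
have d_ge0 k : 0 <= d 0 k.
  have -> : d 0 k = (P *m A *m P ^t*)%sesqui k k.
    rewrite AE !mulmxA (unitarymxP PU) mul1mx -mulmxA (unitarymxP PU) mulmx1.
    by rewrite mxE eqxx.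
  have := M_psd (fun i => (P k (enum_rank i))^*).
  rewrite exchange_big /=; congr (_ <= _).
  rewrite mxE (reindex (@enum_rank I)) /=; last exact/onW_bij/enum_rank_bij.
  apply: eq_bigr => j _; rewrite !mxE (reindex (@enum_rank I)) /=; last first.
    exact/onW_bij/enum_rank_bij.
  rewrite mulr_suml; apply: eq_bigr => i _.
  by rewrite !mxE !enum_rankK conjCK.
exists (fun k i => sqrtC (d 0 (enum_rank k)) * P (enum_rank k) (enum_rank i)).
move=> i j.
have -> : M i j = A (enum_rank i) (enum_rank j) by rewrite mxE !enum_rankK.
rewrite AE mxE (reindex (@enum_rank I)) /=; last exact/onW_bij/enum_rank_bij.
apply: eq_bigr => k _; rewrite mul_mx_diag !mxE rmorphM /=.
rewrite [(sqrtC _)^*]geC0_conj ?sqrtC_ge0 //.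
by rewrite -[in LHS](sqrtCK (d 0 _)) expr2; ring.
Qed.

End Gram.

(** * Linear maps on finite sums, and Gram matrices from a trace *)

Lemma linear_comb (R : pzRingType) (U V : lmodType R) (f : U -> V)
    (I : finType) (c : I -> R) (F : I -> U) :
  linear f -> f (\sum_i c i *: F i) = \sum_i c i *: f (F i).
Proof.
move=> fL; have fZ := scalable_linear fL.
under [RHS]eq_bigr do rewrite -fZ.
apply: (big_morph f) => [x y|]; first by rewrite -[x]scale1r fL !scale1r.
by rewrite -[X in f X](scale0r 0) fZ; exact: scale0r.
Qed.

Lemma linear_sumE (R : pzRingType) (U V : lmodType R) (f : U -> V)
    (I : finType) (F : I -> U) :
  linear f -> f (\sum_i F i) = \sum_i f (F i).
Proof.
move=> fL; have := linear_comb (fun=> 1) F fL.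
under eq_bigr do rewrite scale1r.
by under [X in _ = X]eq_bigr do rewrite scale1r.
Qed.

(** The quadratic form at xi is the sum over k of tau(x_k^* x_k), where x_k is the combination of
    the [w k i] with coefficients [xi i]; positivity of tau applies to each term. *)
Lemma trace_gram (C : numClosedFieldType) (A : unitalStarAlgType C)
    (tau : A -> C) (K I : finType) (w : K -> I -> A) :
  tracial_state tau ->
  exists N : I -> I -> C, forall i j,
    \sum_k tau (smul (star (w k i)) (w k j)) = \sum_m (N m i)^* * N m j.
Proof.
move=> [tau_lin tau_pos _ _]; apply: psd_gram => xi.
pose x k := \sum_i xi i *: w k i.
suff -> : \sum_i \sum_j (xi i)^* *
    (\sum_k tau (smul (star (w k i)) (w k j))) * xi j =
    \sum_k tau (smul (star (x k)) (x k)).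
  by apply: sumr_ge0 => k _; apply: tau_pos; exists (x k).
have -> : \sum_k tau (smul (star (x k)) (x k)) = \sum_k \sum_i \sum_j
    (xi i)^* * tau (smul (star (w k i)) (w k j)) * xi j.
  apply: eq_bigr => k _; rewrite star_sum smul_suml.
  under eq_bigr do rewrite starZ smulZl.
  rewrite (linear_comb (V := C^o) _ _ tau_lin); apply: eq_bigr => i _.
  rewrite smul_sumr; under eq_bigr do rewrite smulZr.
  rewrite (linear_comb (V := C^o) _ _ tau_lin) scaler_sumr.
  by apply: eq_bigr => j _; rewrite /GRing.scale /= [xi j * _]mulrC mulrA.
rewrite [RHS]exchange_big; apply: eq_bigr => i _.
rewrite [RHS]exchange_big; apply: eq_bigr => j _.
by rewrite -mulr_suml -mulr_sumr.
Qed.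

(** * Matrix units and transposition in C(Q) *)

Section FdTensorTheory.
Variables (C : numClosedFieldType) (Q : finQSpace).

Lemma ixTK : involutive (@ixT Q).
Proof. by case=> l [s t]. Qed.

Lemma fdalgE (x : fdalg C Q) : x = \sum_q (x q : C) *: munit q.
Proof.
have E p q : ((x q : C) *: munit q : fdalg C Q) p = (p == q)%:R * x q :> C.
  by rewrite fdtensorZE [RHS]mulrC; congr (_ * _); exact: munitE.
apply/ffunP => p; rewrite sum_ffunE.
transitivity (\sum_q ((p == q)%:R * (x q : C)) : C).
  by under eq_bigr do rewrite eq_sym; rewrite sum_deltal.
by apply: eq_bigr => q _; exact/esym/E.
Qed.

Lemma smul_elem_tensor (B : starAlgType C) (x y : fdalg C Q) (a b : B) :
  smul (elem_tensor x a) (elem_tensor y b) = elem_tensor (smul x y) (smul a b).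
Proof.
apply/ffunP => p; rewrite !ffunE scaler_suml.
by apply: eq_bigr => r _; rewrite !ffunE smulZl smulZr scalerA.
Qed.

Lemma star_elem_tensor (B : starAlgType C) (x : fdalg C Q) (a : B) :
  star (elem_tensor x a) = elem_tensor (star x) (star a).
Proof. by apply/ffunP => p; rewrite !ffunE starZ. Qed.

Lemma smul_munit (l : 'I_(nblocks Q)) (i j k : 'I_(bsize l)) :
  smul (munit (ix i j) : fdalg C Q) (munit (ix j k)) = munit (ix i k).
Proof.
(* Row and column indices of different blocks have different types, so they are compared as
   naturals. *)
have ixE (l' : 'I_(nblocks Q)) (s t : 'I_(bsize l')) (a b : 'I_(bsize l)) :
    (ix s t == ix a b) = [&& l' == l, s == a :> nat & t == b :> nat].
  rewrite -tag_eqE /tag_eq /=; case: eqVneq => // e.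
  by subst l'; rewrite tagged_asE.
apply/ffunP => -[l' [s t]]; rewrite ffunE /=.
transitivity (\sum_(r < bsize l')
    ((ix s r == ix i j)%:R * (ix r t == ix j k)%:R) : C).
  by apply: eq_bigr => r _; congr (_ * _); exact: munitE.
transitivity ((ix s t == ix i k)%:R : C); last exact/esym/munitE.
rewrite ixE; under eq_bigr do rewrite !ixE.
case: eqVneq => [e|_] /=; last by apply: big1 => r _; rewrite mul0r.
subst l'; rewrite (bigD1 j) //= eqxx andbT big1 ?addr0 -?natrM ?mulnb // => r.
by rewrite -val_eqE => /negbTE ->; rewrite andbF mul0r.
Qed.

Lemma sum_munit_index (V : nmodType) (F : munit_index Q -> V) :
  \sum_q F q =
  \sum_(l < nblocks Q) \sum_(i < bsize l) \sum_(j < bsize l) F (ix i j).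
Proof.
under [RHS]eq_bigr do rewrite pair_big /=.
by rewrite sig_big_dep; apply: eq_bigr => -[l [i j]].
Qed.

Lemma fdalg_oneE : (sone : fdalg C Q) =
  \sum_(k < nblocks Q) \sum_(i < bsize k) munit (ix i i).
Proof.
transitivity (\sum_q ((sone : fdalg C Q) q : C) *: munit q : fdalg C Q).
  exact: fdalgE.
rewrite sum_munit_index; apply: eq_bigr => k _; apply: eq_bigr => i _.
have E j : (sone : fdalg C Q) (ix i j) = (if i == j then 1 else 0 : C).
  by rewrite ffunE.
rewrite (bigD1 i) //= big1 ?addr0; first by rewrite E eqxx scale1r.
by move=> j /negbTE ne; rewrite E eq_sym ne scale0r.
Qed.

(** Blockwise transposition: a unital *-isomorphism of C(Q) onto its opposite algebra. *)
Definition fdtr (x : fdalg C Q) : fdalg C Q := [ffun q => x (ixT q)].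

Lemma fdtrE (x : fdalg C Q) : fdtr x = \sum_q (x q : C) *: munit (ixT q).
Proof.
transitivity (\sum_q (fdtr x q : C) *: munit q : fdalg C Q).
  exact: fdalgE.
transitivity (\sum_q (fdtr x (ixT q) : C) *: munit (ixT q) : fdalg C Q).
  exact: (reindex_inj (inv_inj ixTK)).
by apply: eq_bigr => q _; congr (_ *: _); rewrite ffunE ixTK.
Qed.

Lemma fdtr_munit q : fdtr (munit q) = munit (ixT q).
Proof.
apply/ffunP => p; rewrite ffunE.
transitivity ((ixT p == q)%:R : C); first exact: munitE.
by rewrite (inv_eq ixTK); exact/esym/munitE.
Qed.

Lemma fdtr_linear : linear fdtr.
Proof. by move=> c x y; apply/ffunP => p; rewrite !ffunE. Qed.

Lemma fdtrM (x y : fdalg C Q) : fdtr (smul x y) = smul (fdtr y) (fdtr x).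
Proof.
apply/ffunP => -[l [s t]]; rewrite !ffunE; apply: eq_bigr => r _.
by rewrite !ffunE; exact: mulrC.
Qed.

Lemma fdtr_star (x : fdalg C Q) : fdtr (star x) = star (fdtr x).
Proof. by apply/ffunP => -[l [s t]]; rewrite !ffunE. Qed.

Lemma fdtr1 : fdtr sone = sone.
Proof. by apply/ffunP => -[l [s t]]; rewrite !ffunE /= eq_sym. Qed.

End FdTensorTheory.

(** * The map Theta and its behaviour under tau *)

Section Twist.
Variables (C : numClosedFieldType) (P O : finQSpace).
Local Notation CC Q := (fdtensor Q (fdalg C Q)).
Variables (A : unitalStarAlgType C) (Phi : fdalg C O -> fdtensor P A).
Hypothesis Phi_hom : unital_star_hom Phi.

Let PhiL : linear Phi. Proof. by case: Phi_hom => -[]. Qed.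
Let PhiM x y : Phi (smul x y) = smul (Phi x) (Phi y).
Proof. by case: Phi_hom => -[_ H _] _; exact: H. Qed.
Let PhiS x : Phi (star x) = star (Phi x).
Proof. by case: Phi_hom => -[_ _ H] _; exact: H. Qed.

(* The map Phi^op is b |-> (Phi (b^T))^T; [fdtr] and [ixT] are the two        *)
(* transpositions.                                                            *)
Definition twist (y : CC O) (p p' : munit_index P) : A :=
  \sum_q smul (Phi (munit q) p) (Phi (fdtr (y q)) (ixT p')).

Lemma twist_linear p p' : linear (fun y => twist y p p').
Proof.
move=> c y z; rewrite /twist scaler_sumr -big_split /=; apply: eq_bigr => q _.
by rewrite !ffunE fdtr_linear PhiL !ffunE smulDr smulZr.
Qed.

Lemma twist_elem_tensor x b p p' :
  twist (elem_tensor x b) p p' = smul (Phi x p) (Phi (fdtr b) (ixT p')).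
Proof.
rewrite [in RHS](fdalgE x) (linear_comb _ _ PhiL) sum_ffunE smul_suml.
apply: eq_bigr => q _; rewrite elem_tensorE ffunE smulZl -smulZr.
congr (smul _ _).
have <- : (x q : C) *: fdtr b = fdtr ((x q : C) *: b).
  by apply/ffunP => r; rewrite !ffunE.
by rewrite (scalable_linear PhiL) ffunE.
Qed.

Lemma twistE y p p' : twist y p p' = \sum_q \sum_q' (y q q' : C) *:
  smul (Phi (munit q) p) (Phi (munit (ixT q')) (ixT p')).
Proof.
apply: eq_bigr => q _; rewrite fdtrE (linear_comb _ _ PhiL) sum_ffunE smul_sumr.
by apply: eq_bigr => q' _; rewrite ffunE smulZr.
Qed.

Lemma tau_twist_gram (tau : A -> C) (x y : CC O) l l'
    (s t : 'I_(bsize l)) (s' t' : 'I_(bsize l')) : tracial_state tau ->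
  tau (twist (smul (star x) y) (ix s t) (ix s' t')) =
  \sum_r \sum_r' tau (smul (star (twist x (ix r s) (ix r' s')))
                          (twist y (ix r t) (ix r' t'))).
Proof.
move=> [tauL _ _ tauC].
have twist_sum (F : munit_index O -> CC O) p p' :
    twist (\sum_q F q) p p' = \sum_q twist (F q) p p'.
  exact: (linear_sumE _ (twist_linear p p')).
have tau_sum (I : finType) (F : I -> A) : tau (\sum_i F i) = \sum_i tau (F i).
  exact: (linear_sumE (V := C^o) _ tauL).
(* Both sides are sesquilinear in (x, y), so elementary tensors suffice. *)
rewrite [x]fdtensorE [y]fdtensorE star_sum smul_suml twist_sum tau_sum.
under [RHS]eq_bigr do under eq_bigr do
  rewrite !twist_sum star_sum smul_suml tau_sum.
under [RHS]eq_bigr do rewrite exchange_big.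
rewrite [RHS]exchange_big; apply: eq_bigr => q _.
rewrite smul_sumr twist_sum tau_sum.
under [RHS]eq_bigr do under eq_bigr do rewrite smul_sumr tau_sum.
under [RHS]eq_bigr do rewrite exchange_big.
rewrite [RHS]exchange_big; apply: eq_bigr => q' _.
move: (munit q) (x q) (munit q') (y q') => {x y} a b c d.
rewrite star_elem_tensor smul_elem_tensor twist_elem_tensor fdtrM fdtr_star.
rewrite !PhiM !PhiS !ffunE smul_suml tau_sum; apply: eq_bigr => r _.
rewrite smul_sumr tau_sum; apply: eq_bigr => r' _.
rewrite !twist_elem_tensor !ffunE starM.
(* Transposition put the adjoint entry coming from x last; traciality moves it to the front, where
   it completes the adjoint of an entry of Theta(x). *)
by rewrite !smulA [LHS]tauC !smulA.
Qed.

End Twist.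

Lemma sum_triple (V : nmodType) (I J K : finType) (F : I * J * K -> V) :
  \sum_m F m = \sum_i \sum_j \sum_k F (i, j, k).
Proof.
rewrite pair_bigA pair_bigA /=.
by apply: eq_bigr => -[[i j] k].
Qed.

(** * Unitality, complete positivity and synchronicity of tau o Theta *)

Section TwistedTrace.
Variables (C : numClosedFieldType) (P O : finQSpace).
Local Notation CC Q := (fdtensor Q (fdalg C Q)).
Variables (A : unitalStarAlgType C) (Phi : fdalg C O -> fdtensor P A).
Hypothesis Phi_hom : unital_star_hom Phi.
Variable tau : A -> C.
Hypothesis tau_tr : tracial_state tau.
Variable T : CC O -> CC P.
Hypothesis T_twist : forall y p p', T y p p' = tau (twist Phi y p p') :> C.

Lemma tau_twist_linear : linear T.
Proof.
case: tau_tr => tauL _ _ _ c x y; apply/ffunP => p; apply/ffunP => p'.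
transitivity (c * T x p p' + T y p p' : C); last by rewrite !ffunE.
by rewrite !T_twist (twist_linear Phi_hom) tauL.
Qed.

Lemma tau_twist_unital : T sone = sone.
Proof.
case: tau_tr Phi_hom => tauL _ tau1 _ [[_ _ _] Phi1].
apply/ffunP => -[l [s t]]; apply/ffunP => -[l' [s' t']].
rewrite [LHS]T_twist.
have -> : (sone : CC O) = elem_tensor (sone : fdalg C O) sone.
  apply/ffunP => q; rewrite !ffunE /=.
  by case: eqP => _; rewrite ?scale1r ?scale0r.
rewrite (twist_elem_tensor Phi_hom) fdtr1 Phi1 !ffunE /=.
have tau0 : tau 0 = 0.
  by rewrite -[0 in LHS](scale0r 0) (scalable_linear tauL); exact: mul0r.
case: (s == t); rewrite !ffunE /= ?smul0l ?tau0 // eq_sym.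
by case: (s' == t'); rewrite ?smul0r ?smul1l.
Qed.

Lemma tau_twist_cp : completely_positive T.
Proof.
move=> n x [y ->]; case: (tau_tr) => tauL _ _ _.
(* In the (l, l') block, the triples index Mat_(n+1) (x) Mat_(m_l) (x) Mat_(m_l'); [w l l' k i] is
   the entry of Theta(y) in row [k] and column [i]. *)
pose w l l' (k : 'I_n.+1 * 'I_(bsize l) * 'I_(bsize l'))
    (i : 'I_n.+1 * 'I_(bsize l) * 'I_(bsize l')) : A :=
  twist Phi (y (@ix (matQSpace n) ord0 k.1.1 i.1.1))
    (@ix P l k.1.2 i.1.2) (@ix P l' k.2 i.2).
pose N l l' := projT1 (cid (trace_gram (@w l l') tau_tr)).
have NE l l' i j : \sum_k tau (smul (star (w l l' k i)) (w l l' k j)) =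
    \sum_m (N l l' m i)^* * N l l' m j.
  exact: (projT2 (cid (trace_gram (@w l l') tau_tr))).
move: N NE => N NE.
(* The blockwise Gram factors, reassembled into one square root of the image of x. *)
pose z : fdtensor (matQSpace n) (CC P) := [ffun a : munit_index (matQSpace n) =>
  [ffun p : munit_index P => [ffun p' : munit_index P =>
    N (tag p) (tag p') ((tagged a).1, (tagged p).1, (tagged p').1)
                       ((tagged a).2, (tagged p).2, (tagged p').2) : C^o]]].
exists z.
have mulE (B : starAlgType C) (u : fdtensor (matQSpace n) B) (a b : 'I_n.+1) :
    smul (star u) u (@ix (matQSpace n) ord0 a b) =
    \sum_(c < n.+1) smul (star (u (@ix (matQSpace n) ord0 c a)))
                         (u (@ix (matQSpace n) ord0 c b)).
  by rewrite ffunE; apply: eq_bigr => c _; rewrite ffunE.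
apply/ffunP => -[k [a b]]; apply/ffunP => -[l [s t]].
apply/ffunP => -[l' [s' t']]; rewrite (ord1 k) ffunE [LHS]T_twist.
transitivity (\sum_(m : 'I_n.+1 * 'I_(bsize l) * 'I_(bsize l'))
   (N l l' m (a, s, s'))^* * N l l' m (b, t, t')).
  rewrite -NE mulE (linear_sumE _ (twist_linear Phi_hom _ _)).
  rewrite (linear_sumE (V := C^o) _ tauL) sum_triple.
  by apply: eq_bigr => c _; rewrite (tau_twist_gram Phi_hom).
rewrite mulE sum_ffunE sum_ffunE sum_triple; apply: eq_bigr => c _.
rewrite ffunE sum_ffunE; apply: eq_bigr => r _.
rewrite ffunE; apply: eq_bigr => r' _.
by rewrite !ffunE.
Qed.

(** For fixed s, the sum over t is the matrix product giving the (s,s) entry of Phi(e_ij) Phi(e_ji),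
    and e_ij e_ji = e_ii. *)
Lemma tau_twist_munit (l : 'I_(nblocks P)) (k : 'I_(nblocks O))
    (i j : 'I_(bsize k)) :
  \sum_(s < bsize l) \sum_(t < bsize l)
    T (elem_tensor (munit (ix i j)) (munit (ix i j))) (ix s t) (ix s t) =
  \sum_(s < bsize l) tau (Phi (munit (ix i i)) (ix s s)) :> C.
Proof.
case: tau_tr Phi_hom => tauL _ _ _ [[PhiL PhiM _] _].
apply: eq_bigr => s _; rewrite -(smul_munit C i j i) PhiM ffunE.
rewrite (linear_sumE (V := C^o) _ tauL); apply: eq_bigr => t _.
by rewrite T_twist (twist_elem_tensor Phi_hom) fdtr_munit.
Qed.

Lemma tau_twist_synchronous :
  \sum_(k < nblocks O) \sum_(l < nblocks P)
    \sum_(i < bsize k) \sum_(j < bsize k) \sum_(s < bsize l) \sum_(t < bsize l)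
      ((bsize k * bsize l)%N%:R)^-1 *
        T (elem_tensor (munit (ix i j)) (munit (ix i j))) (ix s t) (ix s t)
  = (nblocks P)%:R :> C.
Proof.
have m_neq0 (Q : finQSpace) (l : 'I_(nblocks Q)) : (bsize l)%:R != 0 :> C.
  by rewrite pnatr_eq0 -lt0n bsize_gt0.
have trE k l : \sum_(i < bsize k) \sum_(j < bsize k) \sum_(s < bsize l)
    \sum_(t < bsize l) ((bsize k * bsize l)%N%:R)^-1 *
      (T (elem_tensor (munit (ix i j)) (munit (ix i j))) (ix s t) (ix s t) : C)
    =
    (bsize l)%:R^-1 * \sum_(s < bsize l) \sum_(i < bsize k)
      tau (Phi (munit (ix i i)) (ix s s)).
  rewrite [in RHS]exchange_big /= mulr_sumr; apply: eq_bigr => i _.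
  under [LHS]eq_bigr do under eq_bigr do rewrite -mulr_sumr.
  under [LHS]eq_bigr do rewrite -mulr_sumr tau_twist_munit.
  (* The summand no longer depends on j, so the sum over j gives n_k, cancelling 1/n_k. *)
  rewrite sumr_const card_ord -[LHS]mulr_natl mulrA natrM invfM mulrA divff //.
  by rewrite mul1r.
under eq_bigr do under eq_bigr do rewrite trE.
rewrite exchange_big /= -[nblocks P in RHS]card_ord -sumr_const.
apply: eq_bigr => l _; rewrite -mulr_sumr exchange_big /=.
case: tau_tr Phi_hom => tauL _ tau1 _ [[PhiL _ _] Phi1].
(* Summed over k and i, the e_ii give the unit, and Phi(1) has (s,s) entry 1; each s then
   contributes tau(1) = 1, and the m_l of them cancel 1/m_l. *)
rewrite (eq_bigr (fun=> 1)) ?sumr_const ?card_ord ?mulVf // => s _.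
transitivity (tau (Phi sone (ix s s))); last by rewrite Phi1 ffunE eqxx.
rewrite fdalg_oneE (linear_sumE _ PhiL) sum_ffunE.
rewrite (linear_sumE (V := C^o) _ tauL); apply: eq_bigr => k _.
rewrite (linear_sumE _ PhiL) sum_ffunE.
by rewrite (linear_sumE (V := C^o) _ tauL).
Qed.

End TwistedTrace.

(** * Identification of T_tau with tau o Theta, and conclusion *)

Lemma sum_scale_munit2 (C : numClosedFieldType) (Q : finQSpace)
    (G : munit_index Q -> munit_index Q -> C) p p' :
  (\sum_q \sum_q' G q q' *: elem_tensor (munit q) (munit q' : fdalg C Q)) p p' =
  G p p' :> C.
Proof.
rewrite sum_ffunE sum_ffunE.
transitivity (\sum_q (p == q)%:R * (\sum_q' (p' == q')%:R * G q q') : C).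
  apply: eq_bigr => q _; rewrite sum_ffunE sum_ffunE mulr_sumr.
  apply: eq_bigr => q' _; rewrite !fdtensorZE mulrA [RHS]mulrC.
  by congr (_ * _); exact: munit2E.
under eq_bigr do rewrite eq_sym; rewrite sum_deltal.
by under eq_bigr do rewrite eq_sym; rewrite sum_deltal.
Qed.

Lemma T_trace_twist (R : realType) (P O : finQSpace) (A : unitalCStarAlgType R)
    (Phi : fdalg R[i] O -> fdtensor P A) (tau : A -> R[i])
    (y : fdtensor O (fdalg R[i] O)) p p' :
  unital_star_hom Phi -> scalar tau ->
  T_trace Phi tau y p p' = tau (twist Phi y p p') :> R[i].
Proof.
move=> Phi_hom tauL; rewrite (twistE Phi_hom).
rewrite (linear_sumE (V := R[i]^o) _ tauL).
rewrite /T_trace sum_ffunE sum_ffunE; apply: eq_bigr => q _.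
rewrite (linear_comb (V := R[i]^o) _ _ tauL).
rewrite sum_ffunE sum_ffunE; apply: eq_bigr => q' _.
rewrite !fdtensorZE; congr (_ * _).
exact: (sum_scale_munit2 (fun p p' => tau (smul (Vcoef Phi q p)
  (Vcoef Phi (ixT q') (ixT p'))))).
Qed.

Theorem theorem6p5 (R : realType) (P O : finQSpace) (A : unitalCStarAlgType R)
    (Phi : fdalg R[i] O -> fdtensor P A)
    (hPhi : universal_family Phi)
    (tau : A -> R[i]) (htau : tracial_state tau) :
  correlation (T_trace Phi tau) /\ synchronous (T_trace Phi tau).
Proof.
have [Phi_hom _] := hPhi; have [tauL _ _ _] := htau.
have E y p p' := T_trace_twist y p p' Phi_hom tauL.
split; last exact: (tau_twist_synchronous Phi_hom htau E).
split; first exact: (tau_twist_linear Phi_hom htau E).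
  exact: (tau_twist_cp Phi_hom htau E).
exact: (tau_twist_unital Phi_hom htau E).
Qed.
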